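(* Let $\lambda$ be an admissible capacity on an interval $I$, and let $\tilde\lambda$ be the symmetric capacity, i.e. $\tilde\lambda(u)=\lambda(-u)$ for $u\in-I$. Let $x,x_0\in\overline I$. Let $X$ be a Brownian burglar of intensity $\nu\in\mathbb{R}$ and initial capacity $\lambda$, starting from $x$ and targeting $x_0$. Then $(-X_t)_{t\ge0}$ has the law of a Brownian burglar of intensity $\nu$, initial capacity $\tilde\lambda$, starting from $-x$ and targeting $-x_0$.
   Context: **Capacities.** Open intervals $I\subset\mathbb{R}$ may be unbounded; $\overline I=I\cup\{\inf I,\sup I\}$ and $\overline{\mathbb{R}}=\mathbb{R}\cup\{\pm\infty\}$. A capacity on $I$ is a continuous $\lambda:I\to(0,\infty)$. It is admissible if for some (hence all) $c\in I$, $\int_{\inf I}^c du/\lambda(u)=\int_c^{\sup I}du/\lambda(u)=+\infty$. A stretching morphism from an admissible capacity $\lambda$ on $I$ to an admissible capacity $\rho$ on $J$ is an increasing diffeomorphism $g:I\to J$ with $g'(x)=\rho(g(x))/\lambda(x)$ for all $x\in I$, extended to $\overline I\to\overline J$. The signed indicator is $\mathbbm{1}_{(a,b)}(y)=\mathbf 1_{\{a<y<b\}}-\mathbf 1_{\{b<y<a\}}$ (endpoints possibly infinite). All processes are geometric paths, considered up to time-reparametrization. **Burglar driver.** For $\nu\in\mathbb{R}$, $z,z_0\in\overline{\mathbb{R}}$, the burglar driver of parameter $\nu$ started from $z$ and targeting $z_0$ is the continuous diffusion $D$ on $\overline{\mathbb{R}}$ with $D_0=z$ and $dD_t=e^{\cosh(D_t)}dB_t+e^{2\cosh(D_t)}(1-\nu)\,\mathrm{sign}(D_t-z_0)\,dt$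 ($B$ a standard Brownian motion), instantly reflected at $\pm\infty$. If $z_0=\pm\infty$ it is stopped at $T(D)=\inf\{t:D_t=z_0\}$; otherwise $T(D)=+\infty$. **Brownian burglar.** Let $\lambda_0$ be admissible on $I$ and $x,x_0\in\overline I$. Let $g_0$ be any stretching morphism from $\lambda_0$ to the constant capacity $1$ on $\mathbb{R}$, $z_0=g_0(x_0)$, and $D$ the burglar driver of parameter $\nu$ started from $g_0(x)$ and targeting $z_0$. For $y\in I$ let $g_t(y)$ solve $g_t(y)=g_0(y)+\int_0^t\mathbbm{1}_{(z_0,g_s(y))}(D_s)\,d[D]_s$ until $T(y)=\inf\{t:g_t(y)=\pm\infty\}$; then $g_t$ is an increasing $C^1$-diffeomorphism from $I_t=\{y:T(y)>t\}$ to $\mathbb{R}$, extended to $\overline{I_t}\to\overline{\mathbb{R}}$. The Brownian burglar of parameter (intensity) $\nu$, initial capacity $\lambda_0$, started from $x$ and targeting $x_0$ is the process $X_t=g_t^{-1}(D_t)\in\overline{I_t}$, with final time $T(X)=T(D)$, defined up to time-change. Its law does not depend on the choice of $g_0$. *)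

(* Defs.v *)
From HB Require Import structures.
From mathcomp Require Import all_boot all_order all_algebra.
From mathcomp Require Import all_classical all_reals all_analysis.
From mathcomp Require Import measurable_realfun.

Set Implicit Arguments.
Unset Strict Implicit.
Unset Printing Implicit Defensive.

Import Order.TTheory GRing.Theory Num.Theory.
Import numFieldNormedType.Exports.

Local Open Scope classical_set_scope.
Local Open Scope ring_scope.

Section Capacities.
Variable R : realType.
Implicit Types (I J : set R) (lambda rho : R -> R).

Definition open_interval I : Prop := [/\ I !=set0, is_interval I & open I].

Definition einf I : \bar R := ereal_inf (EFin @` I).
Definition esup I : \bar R := ereal_sup (EFin @` I).

(* I together with its two endpoints, as a subset of the extended line; this
   is not the topological closure when I is unbounded. *)
Definition ebar I : set (\bar R) := (EFin @` I) `|` [set einf I; esup I].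

Definition capacity I lambda : Prop :=
  [/\ open_interval I, {within I, continuous lambda}
    & forall u, I u -> 0 < lambda u].

Definition admissible I lambda : Prop :=
  capacity I lambda /\
  exists2 c, I c &
    (\int[lebesgue_measure]_(u in (I `&` `]-oo, c])) ((lambda u)^-1)%:E = +oo
     /\ \int[lebesgue_measure]_(u in (I `&` `[c, +oo[)) ((lambda u)^-1)%:E
        = +oo)%E.

(* An increasing bijection with this derivative is automatically a
   C^1-diffeomorphism: the derivative is continuous and positive. *)
Definition stretching_morphism I lambda J rho (g : R -> R) : Prop :=
  [/\ admissible I lambda, admissible J rho, set_bij I J g,
      {in I &, {homo g : y z / y < z}}
    & forall y, I y -> is_derive y 1 g (rho (g y) / lambda y)].

(* Graph of the extension to the endpoints of an increasing bijection g : I -> J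
   between open intervals.  It relates each x in ebar I to exactly one y in
   ebar J, and conversely, so it is read backwards for the inverse of g. *)
Definition extended_graph I J (g : R -> \bar R) (x y : \bar R) : Prop :=
  [\/ exists2 u, I u & x = u%:E /\ y = g u,
      x = einf I /\ y = einf J
    | x = esup I /\ y = esup J].

Definition signed_indicator (a b y : \bar R) : R :=
  ((a < y < b)%E)%:R - ((b < y < a)%E)%:R.

(* sign (a - b), meaningful also when a or b is infinite *)
Definition esign (a b : \bar R) : R := ((b < a)%E)%:R - ((a < b)%E)%:R.

Definition cosh (u : R) : R := (expR u + expR (- u)) / 2.

End Capacities.

(* A trajectory lives on [0, lifetime[, to which the time 0 is added, so that
   the starting point still makes sense when the lifetime is 0. *)
Section GeometricPaths.
Variable R : realType.

Definition life_span (zeta : \bar R) : set R :=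
  [set t | 0 <= t /\ (t = 0 \/ (t%:E < zeta)%E)].

Record trajectory := Trajectory {
  lifetime : \bar R ;
  position : R -> \bar R ;
  lifetime_ge0 : (0 <= lifetime)%E ;
  position_continuous : {within life_span lifetime, continuous position} }.

Implicit Types w : trajectory.

(* Equality of geometric paths, i.e. up to an increasing time change (which is
   a homeomorphism, being an increasing bijection between intervals). *)
Definition same_geometric_path w w' : Prop :=
  exists theta : R -> R,
    [/\ set_bij (life_span (lifetime w)) (life_span (lifetime w')) theta,
        {in life_span (lifetime w) &, {homo theta : s t / s < t}}
      & forall t, life_span (lifetime w) t ->
          position w t = position w' (theta t)].

Definition cylinder : set (set trajectory) :=
  [set E | exists (t : R) (C : set (\bar R)), [/\ 0 <= t, measurable C
    & E = [set w | life_span (lifetime w) t /\ C (position w t)]]].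

(* The sigma-algebra on geometric paths, seen on trajectories. *)
Definition geometric_event : set (set trajectory) :=
  [set E | <<s cylinder >> E /\
    forall w w', same_geometric_path w w' -> E w -> E w'].

Definition random_geometric_path d (Omega : measurableType d)
    (X : Omega -> trajectory) : Prop :=
  forall E, geometric_event E -> measurable (X @^-1` E).

Definition same_geometric_law d (Omega : measurableType d)
    (P : probability Omega R) (X : Omega -> trajectory)
    d' (Omega' : measurableType d') (P' : probability Omega' R)
    (X' : Omega' -> trajectory) : Prop :=
  forall E, geometric_event E -> P (X @^-1` E) = P' (X' @^-1` E).

Lemma opp_position_continuous w : {within life_span (lifetime w),
  continuous (fun t => (- position w t)%E)}.
Proof.
move=> t; apply: continuous_comp; first exact: position_continuous.
exact: oppe_continuous.
Qed.

Definition opp_trajectory w : trajectory :=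
  Trajectory (lifetime_ge0 w) (@opp_position_continuous w).

End GeometricPaths.

Section StochasticCalculus.
Context (R : realType) (d : measure_display) (Omega : measurableType d).
Variable P : probability Omega R.

(* Processes are indexed by times t : R, only t >= 0 being relevant. *)
Implicit Types (F : R -> set (set Omega)) (A : set Omega)
  (H M B : R -> Omega -> R) (D : R -> Omega -> \bar R).

Definition filtration F : Prop :=
  (forall t, 0 <= t -> sigma_algebra setT (F t) /\ F t `<=` measurable) /\
  (forall s t, 0 <= s -> s <= t -> F s `<=` F t).

Definition adapted F d' (T : measurableType d') (Z : R -> Omega -> T) : Prop :=
  forall t, 0 <= t -> forall C, measurable C -> F t (Z t @^-1` C).

Definition continuous_process (T : topologicalType) (Z : R -> Omega -> T)
    : Prop :=
  forall omega, {within [set t | 0 <= t], continuous (Z ^~ omega)}.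

(* B is a standard Brownian motion relative to F: B t - B s is independent of
   F s and N(0, t - s). The second parameter of normal_prob is the standard
   deviation. *)
Definition brownian_motion F B : Prop :=
  [/\ adapted F (B : R -> Omega -> measurableTypeR R),
      continuous_process B,
      forall omega, B 0 omega = 0
    & forall s t A (C : set (measurableTypeR R)), 0 <= s -> s < t -> F s A ->
        measurable C ->
        P (A `&` [set omega | C (B t omega - B s omega)]) =
        (P A * normal_prob 0 (Num.sqrt (t - s)) C)%E].

(* On the event A, S p converges to Z in probability as the mesh of the
   partition s :: p of [s, t] tends to 0. *)
Definition limit_in_probability A (s t : R) (S : seq R -> Omega -> R)
    (Z : Omega -> R) : Prop :=
  forall eps : R, 0 < eps -> exists2 delta : R, 0 < delta &
    forall p, itv_partition s t p ->
      (forall k, (k < size p)%N ->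
         nth t (s :: p) k.+1 - nth t (s :: p) k < delta) ->
      (P (A `&` [set omega | (eps < `|S p omega - Z omega|)%R]) <= eps%:E)%E.

(* Z is the Ito integral of H against M over [s, t], on the event A.  For H, M
   continuous and adapted this limit of left-endpoint Riemann sums is the Ito
   integral; localising to A allows H and M to explode off A. *)
Definition ito_integral A H M (s t : R) (Z : Omega -> R) : Prop :=
  limit_in_probability A s t
    (fun p omega => let u := nth t (s :: p) in
       \sum_(0 <= k < size p)
         H (u k) omega * (M (u k.+1) omega - M (u k) omega)) Z.

Definition quadratic_variation A M (s t : R) (Z : Omega -> R) : Prop :=
  limit_in_probability A s t
    (fun p omega => let u := nth t (s :: p) in
       \sum_(0 <= k < size p) (M (u k.+1) omega - M (u k) omega) ^+ 2) Z.

Definition finite_on D (s t : R) : set Omega :=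
  [set omega | forall u, s <= u <= t -> D u omega \is a fin_num].

Definition fine_process D : R -> Omega -> R := fun t omega => fine (D t omega).

(* Q is the random measure d[D] on the times, for a continuous D on the
   extended line: it is prescribed on the time intervals where D is finite,
   through Q ]s, t] = [D]_t - [D]_s.  The only integrands used below vanish
   when D is infinite. *)
Definition bracket_measure D (Q : R.-ker Omega ~> measurableTypeR R) : Prop :=
  forall s t : R, 0 <= s -> s < t ->
    {ae P, forall omega, finite_on D s t omega -> (Q omega `]s, t]%classic < +oo)%E} /\
    quadratic_variation (finite_on D s t) (fine_process D) s t
      (fun omega => fine (Q omega `]s, t]%classic)).

Definition driver_time (z0 : \bar R) D (omega : Omega) : \bar R :=
  if z0 \is a fin_num then +oo%E
  else ereal_inf [set t%:E | t in [set t | 0 <= t /\ D t omega = z0]].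

(* The stochastic differential equation is required on each [s, t], on the
   event that D is finite there.  Instantaneous reflection at the infinities
   is expressed by D spending there zero Lebesgue time before driver_time. *)
Definition burglar_driver (nu : R) (z z0 : \bar R) D : Prop :=
  exists F B,
  [/\ [/\ filtration F, brownian_motion F B, adapted F D
        & continuous_process D],
      forall omega, D 0 omega = z,
      forall s t : R, 0 <= s -> s < t ->
        ito_integral (finite_on D s t)
          (fun u omega => expR (cosh (fine (D u omega)))) B s t
          (fun omega => fine (D t omega) - fine (D s omega) -
             \int[lebesgue_measure]_(u in `[s, t])
               (expR (2 * cosh (fine (D u omega))) * (1 - nu) *
                esign (D u omega) z0)),
      {ae P, forall omega, lebesgue_measure
        [set t | [/\ 0 <= t, (t%:E < driver_time z0 D omega)%E
                   & D t omega \isn't a fin_num]] = 0%E}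
    & {ae P, forall omega, forall t, 0 <= t ->
        (driver_time z0 D omega <= t%:E)%E -> D t omega = z0}].

End StochasticCalculus.

Section BrownianBurglar.
Variable R : realType.

Definition explosion_time (g : R -> R -> \bar R) (y : R) : \bar R :=
  ereal_inf [set t%:E | t in [set t | 0 <= t /\ g t y \isn't a fin_num]].

(* g t y solves g_t(y) = g_0(y) + \int_0^t 1_(z0, g_s(y))(D_s) d[D]_s up to its
   explosion time, for one realisation D, Q of the driver and of d[D].
   Continuity in the extended line makes g reach an infinity by divergence and
   not by a jump; the values after the explosion time are irrelevant. *)
Definition burglar_flow (I : set R) (g0 : R -> R) (z0 : \bar R)
    (D : R -> \bar R) (Q : {measure set (measurableTypeR R) -> \bar R})
    (g : R -> R -> \bar R) : Prop :=
  forall y, I y ->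
    [/\ g 0 y = (g0 y)%:E,
        {within [set t | 0 <= t], continuous (g ^~ y)}
      & forall t, 0 <= t -> (t%:E < explosion_time g y)%E ->
          g t y = ((g0 y)%:E + \int[Q]_(s in `]0%R, t])
                     (signed_indicator z0 (g s y) (D s))%:E)%E].

Definition flow_domain (I : set R) (g : R -> R -> \bar R) (t : R) : set R :=
  [set y | I y /\ (t%:E < explosion_time g y)%E].

Definition brownian_burglar d (Omega : measurableType d)
    (P : probability Omega R) (nu : R) (I : set R) (lambda : R -> R)
    (x x0 : \bar R) (X : Omega -> trajectory R) : Prop :=
  [/\ admissible I lambda, ebar I x, ebar I x0, random_geometric_path X
    & exists (g0 : R -> R) (D : R -> Omega -> \bar R)
        (Q : R.-ker Omega ~> measurableTypeR R)
        (g : Omega -> R -> R -> \bar R) (z z0 : \bar R),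
      [/\ [/\ stretching_morphism I lambda setT (cst 1) g0,
              extended_graph I setT (EFin \o g0) x z
            & extended_graph I setT (EFin \o g0) x0 z0],
          burglar_driver P nu z z0 D,
          bracket_measure P D Q,
          {ae P, forall omega,
             burglar_flow I g0 z0 (D ^~ omega) (Q omega) (g omega)}
        & {ae P, forall omega, exists w : trajectory R,
             [/\ lifetime w = driver_time z0 D omega,
                 forall t, life_span (lifetime w) t ->
                   extended_graph (flow_domain I (g omega) t) setT
                     (g omega t) (position w t) (D t omega)
               & same_geometric_path w (X omega)]}]].

Definition has_law_of_burglar d (Omega : measurableType d)
    (P : probability Omega R) (nu : R) (I : set R) (lambda : R -> R)
    (x x0 : \bar R) (X : Omega -> trajectory R) : Prop :=
  random_geometric_path X /\
  exists (d' : measure_display) (Omega' : measurableType d')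
    (P' : probability Omega' R) (Y : Omega' -> trajectory R),
    brownian_burglar P' nu I lambda x x0 Y /\ same_geometric_law P X P' Y.

End BrownianBurglar.

(* Main.v *)
Require Import Defs.
From mathcomp Require Import all_boot all_order all_algebra.
From mathcomp Require Import all_classical all_reals all_analysis.
From mathcomp Require Import measurable_realfun.
Set Implicit Arguments.
Unset Strict Implicit.
Import Order.TTheory GRing.Theory Num.Theory.
Import numFieldNormedType.Exports.
Local Open Scope classical_set_scope.
Local Open Scope ring_scope.

(** Reflecting every ingredient of the construction of a burglar X by [u |-> - u]
gives the ingredients of a burglar with the reflected data, so that -X is
itself a burglar, on the same probability space; nothing has to be said about
uniqueness in law.

Let [g0] be the stretching morphism, D the driver, B its Brownian motion and
[g] the flow behind X. Then [u |-> - g0 (- u)] is a stretching morphism from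
the symmetric capacity to 1, and -D is a burglar driver from [- z] targeting
[- z0], with Brownian motion -B: in the equation for D the diffusion
coefficient is even in D, and the drift carries the sign of [D - z0], which is
odd under the joint reflection of D and [z0] ([burglar_driver_opp]). That -B
is again a Brownian motion comes from the symmetry of the centred normal law,
hence from that of Lebesgue measure. The bracket d[D] is unchanged, as the
increments are squared, and the signed indicator is odd, so
[u |-> - g_t (- u)] is the flow driven by -D ([burglar_flow_opp]). Finally the
graph relation between X and D is preserved by reflection, the two endpoints
of each interval being exchanged ([extended_graph_opp]).

Negation has to commute with the integrals of both equations, and an integral
with two infinite parts would be an obstruction. The flow equation is only read before the explosion, when the integral is
finite ([integralN_fin_num]); the drift of the driver is a real-valued
integral, for which both indeterminate forms are sent to 0 ([RintegralN]). *)

Section Reflection.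
Variable R : realType.
Implicit Types (A I : set R) (x y z : \bar R).

(** * Integrals under reflection *)

(** A finite integral cannot be the difference of two infinite parts, the only
case in which negation fails to commute with integration. *)
Lemma integralN_fin_num d (T : measurableType d)
    (m : {measure set T -> \bar R}) (D : set T) (f : T -> R) :
  (\int[m]_(t in D) (f t)%:E)%E \is a fin_num ->
  (\int[m]_(t in D) (- f t)%:E = - \int[m]_(t in D) (f t)%:E)%E.
Proof.
rewrite integralE fin_numB => /andP[_ neg_fin].
rewrite [LHS](@integralN _ T R m D (fun t => (f t)%:E)) -?integralE//.
by apply: fin_num_adde_defl; rewrite fin_numN.
Qed.

(** For an indeterminate integral, both sides are 0: [+oo - +oo] is [-oo] whatever
the order of the terms, and the real value of [-oo] is 0. *)
Lemma RintegralN d (T : measurableType d)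
    (m : {measure set T -> \bar R}) (D : set T) (f : T -> R) :
  (\int[m]_(t in D) (- f t) = - \int[m]_(t in D) f t)%R.
Proof.
have fine_subC (a b : \bar R) : fine (b - a)%E = - fine (a - b)%E.
  by case: a b => [a| |] [b| |] //=; rewrite ?oppr0 ?opprB.
rewrite /Rintegral -[X in integral _ _ X]/(\- (EFin \o f))%E.
by rewrite integralE funeposN funenegN fine_subC -integralE.
Qed.

Lemma ge0_integral_oppr (A : set (measurableTypeR R))
    (f : measurableTypeR R -> \bar R) : measurable A ->
  measurable_fun A f -> (forall u, A u -> 0 <= f u)%E ->
  (\int[lebesgue_measure]_(u in A) f u =
   \int[lebesgue_measure]_(u in -%R @^-1` A) f (- u)%R)%E.
Proof.
move=> mA mf f0.
have mN : measurable_fun (T := measurableTypeR R) (U := measurableTypeR R) setT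
    (-%R : R -> R) by exact: oppr_measurable.
rewrite -(ge0_integral_pushforward mN lebesgue_measure mA mf); last first.
  by move=> u; rewrite inE; exact: f0.
by apply: eq_measure_integral => B mB _; exact/esym/lebesgue_measureN.
Qed.

Lemma normal_prob_oppr (s : R) (C : set (measurableTypeR R)) : s != 0 ->
  measurable C -> normal_prob 0 s (-%R @^-1` C) = normal_prob 0 s C.
Proof.
move=> s0 mC; rewrite /normal_prob [in RHS]ge0_integral_oppr//.
- apply: eq_integral => u _; congr EFin.
  by rewrite (normal_pdfE _ s0) /normal_fun !subr0 sqrrN.
- apply/measurable_EFinP; apply: measurable_funTS; exact: measurable_normal_pdf.
- by move=> u _; rewrite lee_fin normal_pdf_ge0.
Qed.

(** * Capacities and stretching morphisms under reflection *)

Lemma open_interval_oppr I : open_interval I -> open_interval (-%R @^-1` I).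
Proof.
case=> -[c Ic] itvI oI; split.
- by exists (- c); rewrite /= opprK.
- move=> a b Ia Ib u /andP[au ub]; apply: (itvI _ _ Ib Ia).
  by rewrite !lerN2 au ub.
- by apply: open_comp oI => u _; exact: opp_continuous.
Qed.

Lemma einf_oppr I : einf (-%R @^-1` I) = (- esup I)%E.
Proof.
rewrite /einf ereal_infEN; congr (- ereal_sup _)%E.
apply/seteqP; split => t.
- by case=> _ [u Iu <-] <-; exists (- u).
- case=> u Iu <-; exists (- u)%:E; last by rewrite EFinN oppeK.
  by exists (- u); rewrite /= ?opprK.
Qed.

Lemma esup_oppr I : esup (-%R @^-1` I) = (- einf I)%E.
Proof.
have IE : I = -%R @^-1` (-%R @^-1` I).
  by apply/funext => u; rewrite /preimage /= opprK.
by rewrite [in RHS]IE einf_oppr oppeK.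
Qed.

Lemma ebar_oppr I x : ebar I x -> ebar (-%R @^-1` I) (- x)%E.
Proof.
rewrite /ebar einf_oppr esup_oppr => -[[u Iu <-]|[->|->]].
- by left; exists (- u); rewrite //= opprK.
- by right; right.
- by right; left.
Qed.

Lemma capacity_oppr I lambda :
  capacity I lambda -> capacity (-%R @^-1` I) (lambda \o -%R).
Proof.
case=> itvI cl l0; split; [exact: open_interval_oppr| |by move=> u; exact: l0].
have [_ _ oI] := itvI; have [_ _ oI'] := open_interval_oppr itvI.
move: cl; rewrite !continuous_open_subspace// => cl u.
rewrite inE => Iu; apply: continuous_comp; first exact: opp_continuous.
by apply: cl; rewrite inE.
Qed.

Lemma integral_capacity_oppr I lambda A : capacity I lambda -> measurable A ->
  A `<=` I ->
  (\int[lebesgue_measure]_(u in A) ((lambda u)^-1)%:E =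
   \int[lebesgue_measure]_(u in -%R @^-1` A) ((lambda (- u))^-1)%:E)%E.
Proof.
move=> [[_ _ oI] cl l0] mA AI.
apply: (@ge0_integral_oppr _ (fun u => ((lambda u)^-1)%:E)) => //; last first.
  by move=> u /AI /l0 lu; rewrite lee_fin invr_ge0 ltW.
apply/measurable_EFinP; apply: (measurable_funS _ AI); first exact: open_measurable.
apply: subspace_continuous_measurable_fun; first exact: open_measurable.
move: cl; rewrite !continuous_open_subspace// => cl u Iu.
apply: continuousV; last exact: cl.
by apply/lt0r_neq0/l0; rewrite -inE.
Qed.

(** Reflection exchanges the two half-integrals at [c], which both diverge. *)
Lemma admissible_oppr I lambda :
  admissible I lambda -> admissible (-%R @^-1` I) (lambda \o -%R).
Proof.
case=> capI [c Ic [intl intr]]; split; first exact: capacity_oppr.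
have mI (i : interval R) : measurable (I `&` [set` i] : set (measurableTypeR R)).
  apply: measurableI; last exact: measurable_itv.
  by case: capI => -[_ _ oI] _ _; exact: open_measurable.
exists (- c); first by rewrite /= opprK.
split.
- rewrite -intr [RHS](integral_capacity_oppr capI) => [||u []//]; last exact: mI.
  congr (\int[_]_(u in _) _)%E; apply/seteqP; split=> u /= [Iu];
    by rewrite !in_itv/= !andbT lerNr.
- rewrite -intl [RHS](integral_capacity_oppr capI) => [||u []//]; last exact: mI.
  congr (\int[_]_(u in _) _)%E; apply/seteqP; split=> u /= [Iu];
    by rewrite !in_itv/= !andbT lerNl.
Qed.

Lemma set_bij_oppr I (g : R -> R) : set_bij I setT g ->
  set_bij (-%R @^-1` I) setT (fun u => - g (- u)).
Proof.
case=> _ inj surj; split => //.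
- move=> u v; rewrite !inE => Iu Iv /oppr_inj guv.
  by apply: oppr_inj; apply: inj; rewrite ?inE.
- move=> v _; have [u Iu guv] := surj (- v) Logic.I.
  by exists (- u); rewrite /= opprK// guv opprK.
Qed.

(** The two signs produced by the chain rule cancel, and the constant capacity 1
on the whole line is its own reflection. *)
Lemma stretching_morphism_oppr I lambda g :
  stretching_morphism I lambda setT (cst 1) g ->
  stretching_morphism (-%R @^-1` I) (lambda \o -%R) setT (cst 1)
    (fun u => - g (- u)).
Proof.
case=> adI adT bij homo der; split => //.
- exact: admissible_oppr.
- exact: set_bij_oppr.
- move=> u v; rewrite !inE => Iu Iv uv; rewrite ltrN2.
  by apply: homo; rewrite ?inE// ltrN2.
- move=> u Iu.
  have dg : is_derive (- u) 1 g (1 / lambda (- u)) by exact: der.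
  have dgN : is_derive u 1 (g \o -%R) ((1 / lambda (- u)) * -1).
    apply: is_derive1_comp.
  by apply: is_derive_eq (is_deriveN dgN) _; rewrite mulrN1 opprK.
Qed.

(** * Parity of the coefficients of the driver and of the flow *)

Lemma signed_indicator_oppr x y z :
  signed_indicator (- x) (- y) (- z) = - signed_indicator x y z.
Proof.
by rewrite /signed_indicator !lteN2 opprB ![(_ < z)%E && _]andbC.
Qed.

Lemma esign_oppr x y : esign (- x) (- y) = - esign x y.
Proof. by rewrite /esign !lteN2 opprB. Qed.

Lemma cosh_oppr (u : R) : cosh (- u) = cosh u.
Proof. by rewrite /cosh opprK addrC. Qed.

End Reflection.

(** * Reflection of geometric paths *)

Section Paths.
Variable R : realType.
Implicit Types (w : trajectory R) (E : set (trajectory R)).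

Lemma same_geometric_path_opp w w' : same_geometric_path w w' ->
  same_geometric_path (opp_trajectory w) (opp_trajectory w').
Proof.
case=> theta [bij homo pos]; exists theta; split => // t wt /=.
by rewrite (pos t wt).
Qed.

(** Cylinders reflect to cylinders, so the sets with a reflection in the generated
sigma-algebra form a sigma-algebra containing the cylinders. *)
Lemma geometric_event_opp E : geometric_event E ->
  geometric_event (@opp_trajectory R @^-1` E).
Proof.
case=> sE invE; split; last first.
  move=> w w' ww' Ew; apply: invE Ew; exact: same_geometric_path_opp.
pose G := [set A : set (trajectory R) |
  <<s @cylinder R>> (@opp_trajectory R @^-1` A)].
suff : <<s @cylinder R>> `<=` G by apply.
apply: smallest_sub => [|_ [t [C [t0 mC ->]]]].
  split; rewrite /G /=.
  - by rewrite preimage_set0; exact: sigma_algebra0.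
  - by move=> A GA; rewrite setTD preimage_setC -setTD; exact: sigma_algebraCD.
  - by move=> A GA; rewrite preimage_bigcup; exact: sigma_algebra_bigcup.
apply: sub_sigma_algebra; exists t, (-%E @^-1` C); split => //.
by rewrite -[X in measurable X]setTI; exact: oppe_measurable.
Qed.

Lemma random_geometric_path_opp d (Omega : measurableType d)
    (X : Omega -> trajectory R) : random_geometric_path X ->
  random_geometric_path (fun omega => opp_trajectory (X omega)).
Proof. by move=> mX E /geometric_event_opp; exact: mX. Qed.

End Paths.

(** * Reflection of the driver *)

Section Driver.
Context (R : realType) (d : measure_display) (Omega : measurableType d).
Variable P : probability Omega R.
Implicit Types (F : R -> set (set Omega)) (A : set Omega)
  (H M B : R -> Omega -> R) (D : R -> Omega -> \bar R).

Lemma brownian_motion_opp F B : brownian_motion P F B ->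
  brownian_motion P F (fun t omega => - B t omega).
Proof.
case=> adB cB B0 incB; split.
- move=> t t0 C mC; apply: (adB t t0 (-%R @^-1` C)).
  by rewrite -[X in measurable X]setTI; exact: oppr_measurable.
- by move=> omega t; apply: continuous_comp; [exact: cB|exact: opp_continuous].
- by move=> omega; rewrite B0 oppr0.
- move=> s t A C s0 st FA mC.
  have sd0 : Num.sqrt (t - s) != 0 by rewrite gt_eqF// sqrtr_gt0 subr_gt0.
  have mNC : measurable (-%R @^-1` C : set (measurableTypeR R)).
    by rewrite -[X in measurable X]setTI; exact: oppr_measurable.
  rewrite -normal_prob_oppr// -incB//; congr (P (_ `&` _)).
  by apply/seteqP; split => omega /=; rewrite opprD.
Qed.

(** Only the distance between approximation and limit matters, and only on [A]:
this is how the parity of a Riemann sum passes to its limit. *)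
Lemma limit_in_probability_eq A s t S S' Z Z' :
  (forall p omega, A omega ->
    `|S p omega - Z omega| = `|S' p omega - Z' omega|) ->
  limit_in_probability P A s t S Z -> limit_in_probability P A s t S' Z'.
Proof.
move=> SZ lim eps /lim[delta delta0 h]; exists delta => // p sp mesh.
rewrite (_ : _ `&` _ =
  A `&` [set omega | eps < `|S p omega - Z omega|]); first exact: h.
by apply/seteqP; split=> omega /= [Aomega]; rewrite SZ.
Qed.

Lemma finite_on_opp D (s t : R) :
  finite_on (fun u omega => - D u omega)%E s t = finite_on D s t.
Proof.
by apply/seteqP; split=> omega /= fD u su; move: (fD u su); rewrite fin_numN.
Qed.

Lemma driver_time_opp (z0 : \bar R) D omega :
  driver_time (- z0)%E (fun u omega => - D u omega)%E omega =
  driver_time z0 D omega.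
Proof.
rewrite /driver_time fin_numN; case: ifP => // _; congr ereal_inf.
apply/seteqP; split => _ [t [t0 Dt] <-]; exists t => //; split => //.
- exact: oppe_inj.
- by rewrite Dt.
Qed.

Lemma ito_integral_opp A H M (s t : R) Z : ito_integral P A H M s t Z ->
  ito_integral P A H (fun u omega => - M u omega) s t (fun omega => - Z omega).
Proof.
apply: limit_in_probability_eq => p omega _ /=.
rewrite -normrN opprB opprK addrC; congr `|_ + _|.
rewrite -sumrN; apply: eq_bigr => k _.
by rewrite -mulrN; congr (_ * _); rewrite opprD.
Qed.

(** The increments of D enter its bracket through their squares. *)
Lemma bracket_measure_opp D Q : bracket_measure P D Q ->
  bracket_measure P (fun u omega => - D u omega)%E Q.
Proof.
move=> brD s t s0 st; have [Qfin QV] := brD s t s0 st.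
rewrite finite_on_opp; split => //.
apply: limit_in_probability_eq QV => p omega _ /=; congr `|_ - _|.
apply: eq_bigr => k _; rewrite /fine_process !fineN.
by rewrite -sqrrN opprD.
Qed.

(** The diffusion coefficient is even in D and the drift is odd in the pair formed
by D and [z0], so negating the equation of D driven by B gives the equation of
-D driven by -B. *)
Lemma burglar_driver_opp nu (z z0 : \bar R) D : burglar_driver P nu z z0 D ->
  burglar_driver P nu (- z)%E (- z0)%E (fun u omega => - D u omega)%E.
Proof.
case=> F [B [[filF bmB adD cD] D0 sde refl stop]].
exists F, (fun t omega => - B t omega); split.
- split => //; first exact: brownian_motion_opp.
  + move=> t t0 C mC; apply: (adD t t0 (-%E @^-1` C)).
    by rewrite -[X in measurable X]setTI; exact: oppe_measurable.
  + move=> omega t; apply: continuous_comp; first exact: cD.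
    exact: oppe_continuous.
- by move=> omega; rewrite D0.
- move=> s t s0 st; rewrite finite_on_opp.
  have := ito_integral_opp (sde s t s0 st).
  apply: limit_in_probability_eq => p omega _ /=; congr `|_ - _|.
    by apply: eq_bigr => k _; rewrite fineN cosh_oppr.
  rewrite !opprD !fineN opprK; congr (_ + _ - _).
  rewrite -RintegralN; apply: eq_Rintegral => u _.
  by rewrite fineN cosh_oppr esign_oppr mulrN.
- apply: filterS refl => omega; congr (lebesgue_measure _ = _).
  by apply/seteqP; split => t /= [t0]; rewrite driver_time_opp fin_numN.
- apply: filterS stop => omega stop t t0; rewrite driver_time_opp => /(stop t t0).
  by move=> ->.
Qed.

End Driver.

(** * Reflection of the flow *)

Section Flow.
Variable R : realType.
Implicit Types (I : set R) (g : R -> R -> \bar R).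

Lemma explosion_time_opp g (y : R) :
  explosion_time (fun t u => - g t (- u)%R)%E y = explosion_time g (- y).
Proof.
rewrite /explosion_time; congr ereal_inf.
by apply/seteqP; split => _ [t [t0 gt] <-]; exists t => //;
  split => //; move: gt; rewrite fin_numN.
Qed.

Lemma flow_domain_opp I g (t : R) :
  flow_domain (-%R @^-1` I) (fun t u => - g t (- u)%R)%E t =
  -%R @^-1` (flow_domain I g t).
Proof.
by rewrite /flow_domain; apply/seteqP; split => u /=;
  rewrite explosion_time_opp.
Qed.

(** Reflection exchanges the lower endpoints with the upper ones, at the source
and at the target simultaneously. *)
Lemma extended_graph_opp I J (g : R -> \bar R) (x y : \bar R) :
  extended_graph I J g x y ->
  extended_graph (-%R @^-1` I) (-%R @^-1` J) (fun u => - g (- u)%R)%E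
    (- x)%E (- y)%E.
Proof.
case=> [[u Iu [-> ->]]|[-> ->]|[-> ->]].
- by constructor 1; exists (- u); rewrite /= opprK.
- by constructor 3; rewrite !esup_oppr.
- by constructor 2; rewrite !einf_oppr.
Qed.

Lemma before_explosion_fin_num g (t y : R) : 0 <= t ->
  (t%:E < explosion_time g y)%E -> g t y \is a fin_num.
Proof.
move=> t0; apply: contraTT => gt; rewrite -leNgt.
by apply: ereal_inf_lbound; exists t.
Qed.

(** Before the explosion the value of the flow is finite, hence so is the integral
in its equation, which can therefore be negated. *)
Lemma burglar_flow_opp I (g0 : R -> R) (z0 : \bar R) (D : R -> \bar R)
    (Q : {measure set (measurableTypeR R) -> \bar R}) g :
  burglar_flow I g0 z0 D Q g ->
  burglar_flow (-%R @^-1` I) (fun u => - g0 (- u)) (- z0)%E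
    (fun t => - D t)%E Q (fun t u => - g t (- u)%R)%E.
Proof.
move=> flow y Iy; have [g0y cg gE] := flow (- y) Iy; split.
- by rewrite g0y.
- move=> t; apply: continuous_comp; [exact: cg|exact: oppe_continuous].
- move=> t t0; rewrite explosion_time_opp => tT.
  have := before_explosion_fin_num t0 tT; rewrite (gE t t0 tT) fin_numD /=.
  move=> int_fin; rewrite fin_num_oppeD// -integralN_fin_num// EFinN; congr (_ + _)%E.
  by apply: eq_integral => s _; rewrite signed_indicator_oppr.
Qed.

End Flow.

(** * Reflection of the burglar *)

Unset Implicit Arguments.

Theorem proposition3p2 (R : realType) (I : set R) (lambda : R -> R)
    (hlambda : admissible I lambda) (x x0 : \bar R)
    (hx : ebar I x) (hx0 : ebar I x0) (nu : R)
    (d : measure_display) (Omega : measurableType d) (P : probability Omega R)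
    (X : Omega -> trajectory R) (hX : brownian_burglar P nu I lambda x x0 X) :
  has_law_of_burglar P nu [set u | I (- u)] (fun u => lambda (- u))
    (- x)%E (- x0)%E (fun omega => opp_trajectory (X omega)).
Proof.
have setTN : -%R @^-1` setT = [set: R] by exact: preimage_setT.
case: hX => _ _ _ rX [g0 [D [Q [g [z [z0 [[str gx gx0] drv br flow path]]]]]]].
split; first exact: random_geometric_path_opp.
exists d, Omega, P, (fun omega => opp_trajectory (X omega)); split=> //.
split.
- exact: admissible_oppr.
- exact: ebar_oppr.
- exact: ebar_oppr.
- exact: random_geometric_path_opp.
exists (fun u => - g0 (- u)), (fun t omega => - D t omega)%E, Q,
  (fun omega t u => - g omega t (- u)%R)%E, (- z)%E, (- z0)%E; split.
- split; first exact: stretching_morphism_oppr.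
  + by rewrite -setTN; exact: (extended_graph_opp gx).
  + by rewrite -setTN; exact: (extended_graph_opp gx0).
- exact: burglar_driver_opp.
- exact: bracket_measure_opp.
- by apply: filterS flow => omega; exact: burglar_flow_opp.
apply: filterS path => omega [w [lw gw wX]]; exists (opp_trajectory w); split.
- by rewrite driver_time_opp.
- move=> t /gw gt; rewrite -setTN flow_domain_opp; exact: (extended_graph_opp gt).
- exact: same_geometric_path_opp.
Qed.
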